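(* Let $R$ be a commutative ring with unity and let $n\ge 2$ be an integer. (a) Let $p_1,p_2,\ldots,p_n\in R$. If every nonempty subset of $\{p_1,p_2,\ldots,p_n\}$ generates a principal ideal of $R$, then the $n$ products $\prod_{1\le j\le n,\ j\ne i}p_j$ ($i=1,2,\ldots,n$), that is, $p_2p_3p_4\cdots p_n$, $p_1p_3p_4\cdots p_n$, $\ldots$, $p_1p_2p_3\cdots p_{n-1}$, generate a principal ideal of $R$. (b) If $I_1,I_2,\dots,I_n$ are principal ideals in $R$ such that $\sum_{h\in H}I_h$ is a principal ideal for every nonempty set $H\subset\{1,2,\dots,n\}$, then the ideal $$\sum_{i=1}^n\ \prod_{1\le j\le n,\ j\ne i} I_j = I_2I_3I_4\cdots I_n + I_1I_3I_4\cdots I_n +\dots+ I_1I_2\cdots I_{n-1}$$ is also a principal ideal.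
   Context: Sums and products of ideals are the usual ones: $I+J=\{x+y: x\in I,\ y\in J\}$, and $IJ$ is the ideal generated by all products $xy$ with $x\in I$, $y\in J$. *)

(* Defs.v *)
From mathcomp Require Import all_boot all_order all_algebra.
From mathcomp Require Import classical_sets.
Import GRing.Theory.

Set Implicit Arguments.
Unset Strict Implicit.
Unset Printing Implicit Defensive.

Local Open Scope classical_set_scope.
Local Open Scope ring_scope.

(* Ideals are not required to be proper (MathComp's idealr_closed predicates  *)
(* are), and the ring may be the zero ring.                                   *)
Definition is_ideal (R : comPzRingType) (I : set R) : Prop :=
  [/\ I 0,
      forall x y, I x -> I y -> I (x + y)
    & forall r x, I x -> I (r * x)].

Definition ideal_gen (R : comPzRingType) (S : set R) : set R :=
  smallest (@is_ideal R) S.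

Definition is_principal (R : comPzRingType) (I : set R) : Prop :=
  exists a : R, I = ideal_gen [set a].

Definition ideal_add (R : comPzRingType) (I J : set R) : set R :=
  [set x + y | x in I & y in J].

Definition ideal_mul (R : comPzRingType) (I J : set R) : set R :=
  ideal_gen [set x * y | x in I & y in J].

(* The empty sum is the zero ideal and the empty product is the unit ideal.   *)
Definition ideal_sum (R : comPzRingType) (n : nat) (P : pred 'I_n)
    (I : 'I_n -> set R) : set R :=
  \big[@ideal_add R/[set 0]]_(i < n | P i) I i.

Definition ideal_prod (R : comPzRingType) (n : nat) (P : pred 'I_n)
    (I : 'I_n -> set R) : set R :=
  \big[@ideal_mul R/[set: R]]_(i < n | P i) I i.

(* Main.v *)
Require Import Defs.
From mathcomp Require Import all_boot all_order all_algebra.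
From mathcomp Require Import ring.
From mathcomp Require Import classical_sets.
Import GRing.Theory.

Local Open Scope classical_set_scope.
Local Open Scope ring_scope.

(** Write [(s)] for the ideal generated by a finite list [s].  The proof is by
    induction on the number of generators, merging two generators [a] and [b]
    into their least common multiple.

    If [(a, b) = (d)], then [(a) `&` (b)] is also principal, with a generator
    [l] such that [a * b = d * l] ([principal_setI]).  Let [s] be the list of the
    remaining generators and [P] their product.  The products of all but one
    of [a, b, s] are [b * P], [a * P] and the multiples by [a * b] of the
    products of all but one element of [s]; since [(a * P, b * P) = (d * P)]
    and [a * b = d * l], they generate [d] times the ideal of the same kind
    attached to the shorter list [l, s].

    For the induction to go on, every sublist of [l, s] must generate a
    principal ideal.  This is clear without [l]; for a sublist [l, t] it follows
    from the distributivity law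
      [(l, t) = (a, t) `&` (b, t)],
    which holds because [(a, b, t)] is principal ([span_lcm_cons]).  The two
    ideals on the right are principal and so is their sum [(a, b, t)], whence
    their intersection is principal by the same fact as above.

    The second part is the first one read on generators of the [I i]. *)

Section Ideals.
Set Implicit Arguments.
Unset Strict Implicit.
Variable R : comPzRingType.
Implicit Types (a b c d l x y r : R) (s t : seq R) (S I J : set R).

(** * Ideals generated by finite lists *)

Definition span s : set R := ideal_gen [set` s].

Lemma ideal_gen_is_ideal S : is_ideal (ideal_gen S).
Proof.
split=> [I [[]]//|x y Sx Sy I [idI sSI]|r x Sx I [idI sSI]].
  by have [_ + _] := idI; apply; [apply: Sx|apply: Sy].
by have [_ _] := idI; apply; apply: Sx.
Qed.

Lemma span0 s : span s 0.
Proof. by have [] := ideal_gen_is_ideal [set` s]. Qed.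

Lemma spanD s x y : span s x -> span s y -> span s (x + y).
Proof. by have [_ + _] := ideal_gen_is_ideal [set` s]; apply. Qed.

Lemma spanM s r x : span s x -> span s (r * x).
Proof. by have [_ _] := ideal_gen_is_ideal [set` s]; apply. Qed.

Lemma mem_span s x : x \in s -> span s x.
Proof. by move=> sx I [_]; apply. Qed.

Lemma mem_span_head a s : span (a :: s) a.
Proof. by apply: mem_span; rewrite mem_head. Qed.

Lemma span_sub s I : is_ideal I -> {in s, forall x, I x} -> span s `<=` I.
Proof. by move=> idI sI x; apply; split. Qed.

Lemma span_subset s t : {in s, forall x, span t x} -> span s `<=` span t.
Proof. by move=> st; apply: span_sub => //; apply: ideal_gen_is_ideal. Qed.

Lemma span_mono s t : {subset s <= t} -> span s `<=` span t.
Proof. by move=> st; apply: span_subset => x /st; apply: mem_span. Qed.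

Lemma eq_span s t : s =i t -> span s = span t.
Proof.
by move=> st; apply/seteqP; split; apply: span_mono => x; rewrite st.
Qed.

Lemma is_ideal_colon d I : is_ideal I -> is_ideal [set x | I (d * x)].
Proof.
move=> [I0 ID IM]; split=> [|x y|r x] /=; first by rewrite mulr0.
  by rewrite mulrDr; apply: ID.
by rewrite mulrCA; apply: IM.
Qed.

Lemma span_cons a s x :
  span (a :: s) x <-> exists r y, span s y /\ x = r * a + y.
Proof.
split=> [|[r [y [sy ->]]]]; last first.
  apply: spanD; first by apply: spanM; exact: mem_span_head.
  by apply: span_mono sy => z sz; rewrite inE sz orbT.
apply: (@span_sub _ [set x | exists r y, span s y /\ x = r * a + y]) => {x}.
  split=> [|_ _ [r [y [sy ->]]] [r' [y' [sy' ->]]]|q _ [r [y [sy ->]]]] /=.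
  - by exists 0, 0; split; [apply: span0|ring].
  - by exists (r + r'), (y + y'); split; [apply: spanD|ring].
  - by exists (q * r), (q * y); split; [apply: spanM|ring].
move=> x; rewrite inE => /predU1P[->|sx] /=.
  by exists 1, 0; split; [apply: span0|ring].
by exists 0, x; split; [apply: mem_span|ring].
Qed.

Lemma span_nil : span [::] = [set 0].
Proof.
apply/seteqP; split=> [|x ->]; last exact: span0.
by apply: span_sub => //; split=> [|x y -> ->|r x ->] /=; ring.
Qed.

Lemma span1 a x : span [:: a] x <-> exists r, x = r * a.
Proof.
rewrite span_cons; split=> [[r [y []]]|[r ->]].
  by rewrite span_nil => -> ->; exists r; ring.
by exists r, 0; split; [apply: span0|ring].
Qed.

Lemma ideal_gen1 a : ideal_gen [set a] = span [:: a].
Proof. by rewrite /span set_cons1. Qed.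

Lemma is_principal_span1 a : is_principal (span [:: a]).
Proof. by exists a; rewrite ideal_gen1. Qed.

Lemma is_principalP I : is_principal I <-> exists d, I = span [:: d].
Proof. by split=> -[d ->]; exists d; rewrite ideal_gen1. Qed.

(** * Least common multiples *)

(** With [a = q1 * d] and [b = q2 * d], the generator is [l = q1 * q2 * d].
    A Bezout relation [d = u * a + v * b] need not give [u * q1 + v * q2 = 1]
    when [d] is a zero divisor, but [u * q1 + v * q2] does act as [1] on the
    multiples of [d], in particular on the common multiples of [a] and [b]. *)
Lemma principal_setI a b : is_principal (span [:: a; b]) ->
  exists d l, [/\ span [:: a; b] = span [:: d], a * b = d * l
    & span [:: a] `&` span [:: b] = span [:: l]].
Proof.
move=> /is_principalP[d abd].
have [q1 aE] : exists q, a = q * d.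
  by apply/span1; rewrite -abd; exact: mem_span_head.
have [q2 bE] : exists q, b = q * d.
  by apply/span1; rewrite -abd; apply: mem_span; rewrite !inE eqxx orbT.
have : span [:: a; b] d by rewrite abd; exact: mem_span_head.
move=> /span_cons[u [_ [/span1[v ->] dE]]].
exists d, (q1 * q2 * d); split=> //; first by rewrite aE bE; ring.
apply/seteqP; split=> [x [/span1[s xs] /span1[t xt]]|x /span1[r ->]].
  apply/span1; exists (u * t + v * s).
  have -> : x = (u * q1 + v * q2) * x.
    by rewrite {1}xs {1}aE mulrA {1}dE xs aE bE; ring.
  (* [x = b * t] goes into the first summand and [x = a * s] into the second,
     so that both acquire the factor [q1 * q2 * d]. *)
  by rewrite mulrDl {1}xt xs aE bE; ring.
by split; apply/span1; [exists (r * q2); rewrite aE|exists (r * q1); rewrite bE];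
  ring.
Qed.

(** Distributivity.  Let [c] generate [(a, b, t)], with [a = a' * c] and
    [b = b' * c].  The element [a' * b' * c] lies in [(a) `&` (b) = (l)], so
    [a' * (b, t)] and [b' * (a, t)] are both contained in [(l, t)].  Expanding
    [c] as a combination of [a], [b] and [t] in [x = x' * c] writes [x] as a
    combination of [a' * x], [b' * x] and an element of [(t)]. *)
Lemma span_lcm_cons a b l t :
    is_principal (span [:: a, b & t]) ->
    span [:: a] `&` span [:: b] = span [:: l] ->
  span (l :: t) = span (a :: t) `&` span (b :: t).
Proof.
move=> /is_principalP[c abc] abl.
have [/span1[la laE] /span1[lb lbE]] : (span [:: a] `&` span [:: b]) l.
  by rewrite abl; exact: mem_span_head.
apply/seteqP; split=> [x /span_cons[r [y [ty ->]]]|x [ax bx]].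
  split; apply/span_cons.
    by exists (r * la), y; split=> //; rewrite laE mulrA.
  by exists (r * lb), y; split=> //; rewrite lbE mulrA.
have cE z : span [:: a, b & t] z -> exists q, z = q * c.
  by rewrite abc => /span1.
have [a' aE] : exists q, a = q * c.
  by apply: cE; exact: mem_span_head.
have [b' bE] : exists q, b = q * c.
  by apply: cE; apply: mem_span; rewrite !inE eqxx orbT.
have [x' xE] : exists q, x = q * c.
  apply: cE; apply: span_mono ax => z; rewrite !inE.
  by case/orP=> ->; rewrite ?orbT.
have : span [:: a, b & t] c by rewrite abc; exact: mem_span_head.
move=> /span_cons[u [_ [/span_cons[v [w [tw ->]]] cuvw]]].
have tlt y : span t y -> span (l :: t) y.
  by move=> ty; apply/span_cons; exists 0, y; split=> //; ring.
have labc : span (l :: t) (a' * b' * c).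
  have : (span [:: a] `&` span [:: b]) (a' * b' * c).
    by split; apply/span1; [exists b'|exists a']; rewrite ?aE ?bE; ring.
  rewrite abl; apply: span_subset => z; rewrite inE => /eqP ->.
  exact: mem_span_head.
have la'x : span (l :: t) (a' * x).
  move: bx => /span_cons[r [y [ty ->]]].
  have -> : a' * (r * b + y) = r * (a' * b' * c) + a' * y by rewrite bE; ring.
  by apply: spanD; apply: spanM => //; apply: tlt.
have lb'x : span (l :: t) (b' * x).
  move: ax => /span_cons[r [y [ty ->]]].
  have -> : b' * (r * a + y) = r * (a' * b' * c) + b' * y by rewrite aE; ring.
  by apply: spanD; apply: spanM => //; apply: tlt.
have -> : x = u * (a' * x) + (v * (b' * x) + x' * w).
  by rewrite {1}xE cuvw xE {1}aE {1}bE; ring.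
by do 2?[apply: spanD]; apply: spanM => //; apply: tlt.
Qed.

(** The sum of the two ideals whose intersection is [(l, t)] is [(a, b, t)], so
    [principal_setI] applies to their generators. *)
Lemma is_principal_lcm_cons a b l t :
    is_principal (span (a :: t)) -> is_principal (span (b :: t)) ->
    is_principal (span [:: a, b & t]) ->
    span [:: a] `&` span [:: b] = span [:: l] ->
  is_principal (span (l :: t)).
Proof.
move=> /is_principalP[d1 ad1] /is_principalP[d2 bd2] pabt abl.
rewrite (span_lcm_cons pabt abl) ad1 bd2.
suff d12 : span [:: d1; d2] = span [:: a, b & t].
  have [|_ [m [_ _ ->]]] := @principal_setI d1 d2; first by rewrite d12.
  exact: is_principal_span1.
have sa : span (a :: t) `<=` span [:: a, b & t].
  by apply: span_mono => x; rewrite !inE => /orP[]->; rewrite ?orbT.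
have sb : span (b :: t) `<=` span [:: a, b & t].
  by apply: span_mono => x; rewrite !inE => /orP[]->; rewrite ?orbT.
have s1 : span (a :: t) `<=` span [:: d1; d2].
  by rewrite ad1; apply: span_mono => x; rewrite !inE => ->.
have s2 : span (b :: t) `<=` span [:: d1; d2].
  by rewrite bd2; apply: span_mono => x; rewrite !inE => ->; rewrite orbT.
apply/seteqP; split; apply: span_subset => x; rewrite !inE.
  move=> /orP[]/eqP ->.
    by apply: sa; rewrite ad1; exact: mem_span_head.
  by apply: sb; rewrite bd2; exact: mem_span_head.
move=> /or3P[/eqP ->|/eqP ->|tx].
- by apply: s1; exact: mem_span_head.
- by apply: s2; exact: mem_span_head.
- by apply: s1; apply: mem_span; rewrite inE tx orbT.
Qed.

(** * Products of all entries but one *)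

Fixpoint cofactors s : seq R :=
  if s is a :: s' then
    \prod_(x <- s') x :: [seq a * x | x <- cofactors s']
  else [::].

(** Indices, not values, must be distinct: [p] may repeat a value. *)
Lemma cofactors_map (T : eqType) (p : T -> R) (r : seq T) : uniq r ->
  cofactors (map p r) = [seq \prod_(j <- r | j != i) p j | i <- r].
Proof.
elim: r => //= i r IHr /andP[ir ur]; rewrite IHr// big_map; congr (_ :: _).
  rewrite big_cons eqxx /= [LHS]big_seq [RHS]big_seq_cond.
  apply: eq_bigl => j; case jr: (j \in r) => //=.
  by apply/esym; apply: contraNneq ir => <-.
rewrite -map_comp; apply/eq_in_map => k kr /=.
by rewrite big_cons; case: eqVneq ir => // ->; rewrite kr.
Qed.

(** Merging [a] and [b] into [l] divides the ideal of cofactors by [d]: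
    the cofactors of [a] and [b] are [b * P] and [a * P], with [P] the product
    of [s], and generate [(d * P)]; all the others contain the factor
    [a * b = d * l]. *)
Lemma span_cofactors_merge a b d l m s :
    span [:: a; b] = span [:: d] -> a * b = d * l ->
    span (cofactors (l :: s)) = span [:: m] ->
  span (cofactors [:: a, b & s]) = span [:: d * m].
Proof.
move=> abd abl lsm /=; set P := \prod_(x <- s) x.
rewrite big_cons -/P; apply/seteqP; split.
  have dm y : span [:: m] y -> span [:: d * m] (d * y).
    by move=> /span1[r ->]; apply/span1; exists r; ring.
  have dP z : span [:: a; b] z -> span [:: d * m] (z * P).
    rewrite abd => /span1[q ->]; rewrite -mulrA; apply: spanM; apply: dm.
    by rewrite -lsm; exact: mem_span_head.
  apply: span_subset => x; rewrite !inE => /or3P[/eqP ->|/eqP ->|].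
  - by apply: dP; apply: mem_span; rewrite !inE eqxx orbT.
  - by apply: dP; apply: mem_span; rewrite !inE eqxx.
  move=> /mapP[_ /mapP[z sz ->] ->]; rewrite mulrA abl -mulrA; apply: dm.
  by rewrite -lsm; apply: mem_span; rewrite inE map_f ?orbT.
set I := (X in _ `<=` X); apply: span_subset => x; rewrite inE => /eqP -> {x}.
have idI : is_ideal I by apply: ideal_gen_is_ideal.
suff : span (cofactors (l :: s)) `<=` [set x | I (d * x)].
  by rewrite lsm => /(_ m (@mem_span_head m [::])).
apply: span_sub; first exact: is_ideal_colon.
move=> x; rewrite inE => /predU1P[->|/mapP[z sz ->]] /=.
  rewrite mulrC.
  suff : span [:: a; b] `<=` [set x | I (P * x)].
    by rewrite abd => /(_ d (@mem_span_head d [::])).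
  apply: span_sub; first exact: is_ideal_colon.
  move=> y; rewrite !inE => /orP[]/eqP -> /=; rewrite mulrC; apply: mem_span.
    by rewrite !inE eqxx orbT.
  by rewrite mem_head.
rewrite mulrA -abl -mulrA; apply: mem_span.
by rewrite !inE -map_comp (map_f (_ \o _) sz) ?orbT.
Qed.

(** Lists, rather than families or sets, let [l] replace [a] and [b] even when
    it coincides with a remaining generator; [span] sees only the underlying
    set, so a sublist containing [l] can be brought to the form [l :: t] with
    [l] removed from [t]. *)
Lemma is_principal_cofactors s :
    (forall t, {subset t <= s} -> is_principal (span t)) ->
  is_principal (span (cofactors s)).
Proof.
have [k] := ubnP (size s); elim: k s => // k IHk [|a [|b s]] sk ps.
- exact: ps.
- exact: is_principal_span1.
have psab t : {subset t <= s} -> [/\ is_principal (span t),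
    is_principal (span (a :: t)), is_principal (span (b :: t))
  & is_principal (span [:: a, b & t])].
  move=> ts; split; apply: ps => x; rewrite !inE.
  - by move=> /ts ->; rewrite !orbT.
  - by move=> /predU1P[->|/ts ->]; rewrite ?eqxx ?orbT.
  - by move=> /predU1P[->|/ts ->]; rewrite ?eqxx ?orbT.
  - by move=> /or3P[->|->|/ts ->]; rewrite ?orbT.
have [//|_ _ _ /principal_setI[d [l [abd abl alb]]]] := psab [::].
have /is_principalP[m lsm] : is_principal (span (cofactors (l :: s))).
  apply: IHk => // t tls.
  have [lt|lt] := boolP (l \in t); last first.
    have [|//] := psab t => x tx; have := tls x tx; rewrite inE.
    by case/predU1P=> // xl; rewrite -xl tx in lt.
  have -> : span t = span (l :: [seq x <- t | x != l]).
    apply: eq_span => x; rewrite inE mem_filter.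
    by case: eqVneq => // ->; rewrite lt.
  have [|_ pa pb pab] := psab [seq x <- t | x != l].
    by move=> x; rewrite mem_filter => /andP[/negPf xl /tls]; rewrite inE xl.
  exact: is_principal_lcm_cons pa pb pab alb.
by rewrite (span_cofactors_merge abd abl lsm); apply: is_principal_span1.
Qed.

Lemma range_span (T : finType) (p : T -> R) :
  ideal_gen (range p) = span (codom p).
Proof.
congr ideal_gen; apply/seteqP; split=> [_ [i _ <-]|_ /codomP[i ->]].
  exact: codom_f.
by exists i.
Qed.

Lemma is_principal_prod_neq (T : finType) (p : T -> R) :
    (forall t, {subset t <= codom p} -> is_principal (span t)) ->
  is_principal (ideal_gen (range (fun i => \prod_(j | j != i) p j))).
Proof.
move=> /is_principal_cofactors; rewrite range_span codomE cofactors_map ?enum_uniq//.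
by congr (is_principal (span _)); rewrite codomE; apply: eq_map => i;
  rewrite big_enum_cond.
Qed.

(** * Sums and products of principal ideals *)

Lemma big_ideal_add_span1 (T : Type) (r : seq T) (P : pred T) (p : T -> R) :
  \big[@ideal_add R/[set 0]]_(i <- r | P i) span [:: p i] =
  span [seq p i | i <- r & P i].
Proof.
rewrite -big_filter; elim: [seq _ <- _ | _] => [|i {}r IHr] /=.
  by rewrite big_nil span_nil.
rewrite big_cons IHr; apply/seteqP; split=> x.
  by move=> [_ /span1[q ->] [y ry <-]]; apply/span_cons; exists q, y.
move=> /span_cons[q [y [ry ->]]]; exists (q * p i); last by exists y.
by apply/span1; exists q.
Qed.

Lemma ideal_mul_span1 a b :
  ideal_mul (span [:: a]) (span [:: b]) = span [:: a * b].
Proof.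
apply/seteqP; split; last first.
  apply: span_sub; first exact: ideal_gen_is_ideal.
  move=> _ /[1!inE]/eqP -> I [_]; apply; exists a; first exact: mem_span_head.
  by exists b; first exact: mem_span_head.
apply: smallest_sub; first exact: ideal_gen_is_ideal.
move=> _ [_ /span1[q ->] [_ /span1[r ->] <-]].
by apply/span1; exists (q * r); ring.
Qed.

Lemma big_ideal_mul_span1 (T : Type) (r : seq T) (P : pred T) (p : T -> R) :
  \big[@ideal_mul R/[set: R]]_(i <- r | P i) span [:: p i] =
  span [:: \prod_(i <- r | P i) p i].
Proof.
elim/big_rec2: _ => [|i x I _ ->]; last exact: ideal_mul_span1.
by apply/seteqP; split=> // x _; apply/span1; exists x; rewrite mulr1.
Qed.

End Ideals.

Theorem theorem3 (R : comPzRingType) (n : nat) (n_ge2 : (2 <= n)%N) :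
  (forall p : 'I_n -> R,
     (forall S : set R, S `<=` range p -> S !=set0 ->
        is_principal (ideal_gen S)) ->
     is_principal
       (ideal_gen (range (fun i : 'I_n => \prod_(j < n | j != i) p j))))
  /\
  (forall I : 'I_n -> set R,
     (forall i : 'I_n, is_principal (I i)) ->
     (forall H : {set 'I_n}, H != finset.set0 ->
        is_principal (ideal_sum (fun h => h \in H) I)) ->
     is_principal
       (ideal_sum predT
          (fun i : 'I_n => ideal_prod (fun j => j != i) I))).
Proof.
have pnil : is_principal (@span R [::]).
  apply/is_principalP; exists 0; apply/seteqP; split; apply: span_subset => // x.
  by rewrite inE => /eqP ->; apply: span0.
split=> [p pP|I prI sumI].
  apply: is_principal_prod_neq => -[//|x t] xtp; apply: pP.
    by move=> y /xtp/codomP[i ->]; exists i.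
  by exists x; rewrite /= mem_head.
have [p Ip] := fin_all_exists (fun i => (is_principalP (I i)).1 (prI i)).
have -> : ideal_sum predT (fun i => ideal_prod (fun j => j != i) I) =
    ideal_gen (range (fun i : 'I_n => \prod_(j < n | j != i) p j)).
  rewrite /ideal_sum range_span codomE enumT -[X in map _ X]filter_predT.
  rewrite -big_ideal_add_span1; apply: eq_bigr => i _.
  by rewrite -big_ideal_mul_span1; apply: eq_bigr => j _.
apply: is_principal_prod_neq => -[//|x t] xtp.
have [i xpi] : exists i, x = p i by apply/codomP/xtp; rewrite mem_head.
pose H := [set j | p j \in x :: t]%SET.
have : is_principal (ideal_sum (fun h => h \in H) I).
  by apply: sumI; apply/set0Pn; exists i; rewrite inE -xpi mem_head.
rewrite /ideal_sum (eq_bigr (fun j => span [:: p j]))//.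
rewrite big_ideal_add_span1; congr is_principal; apply: eq_span => y.
apply/mapP/idP => [[j /[1!mem_filter]/[1!inE]/andP[+ _] ->]//|yxt].
have /codomP[j yj] := xtp _ yxt.
by exists j => //; rewrite mem_filter mem_index_enum inE -yj yxt.
Qed.
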